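(* Let $\xi=(\tau_L,\delta_L,\tau_R,\delta_R)\in\Phi_{\rm BYG}$ and suppose $J_1(\xi)>1$ and $\lambda_L^s+|\lambda_R^s|<1$. Then there is a filled triangle in $\mathbb{R}^2$ that contains $\Lambda$ and in which the stable manifold $W^s(X)$ is dense.
   Context: For $\xi=(\tau_L,\delta_L,\tau_R,\delta_R)\in\mathbb{R}^4$ define the continuous piecewise-linear map $f_\xi:\mathbb{R}^2\to\mathbb{R}^2$ by $f_\xi(x,y)=(\tau_L x+y+1,\,-\delta_L x)$ if $x\le 0$ and $f_\xi(x,y)=(\tau_R x+y+1,\,-\delta_R x)$ if $x\ge 0$. Let $A_L=\begin{bmatrix}\tau_L&1\\-\delta_L&0\end{bmatrix}$ and $A_R=\begin{bmatrix}\tau_R&1\\-\delta_R&0\end{bmatrix}$. Let $\Phi=\{\xi\in\mathbb{R}^4: \tau_L>\delta_L+1,\ \delta_L>0,\ \tau_R<-(\delta_R+1),\ \delta_R>0\}$. For $\xi\in\Phi$ the eigenvalues of $A_L$ are real with $0<\lambda_L^s<1<\lambda_L^u$, the eigenvalues of $A_R$ are real with $\lambda_R^u<-1<\lambda_R^s<0$, $f_\xi$ is a homeomorphism, and $f_\xi$ has the two saddle fixed points $X=\left(\frac{1}{\delta_R+1-\tau_R},\frac{-\delta_R}{\delta_R+1-\tau_R}\right)$ and $Y=\left(\frac{-1}{\tau_L-\delta_L-1},\frac{\delta_L}{\tau_L-\delta_L-1}\right)$. Let $\phi(\xi)=\delta_R-\left(\tau_R+\delta_L+\delta_R-(1+\tau_R)\lambda_L^u\right)\lambda_L^u$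 and $\Phi_{\rm BYG}=\{\xi\in\Phi:\phi(\xi)>0\}$. Let $J_1(\xi)=\frac{\lambda_L^u(\lambda_R^u)^2}{\lambda_L^u+|\lambda_R^u|}$. The stable manifold is $W^s(X)=\{P\in\mathbb{R}^2: f_\xi^n(P)\to X \text{ as } n\to\infty\}$ and the unstable manifold is $W^u(X)=\{P\in\mathbb{R}^2: f_\xi^{-n}(P)\to X \text{ as } n\to\infty\}$. Let $\Lambda$ be the closure of $W^u(X)$. *)

(* Defs.v *)
From Stdlib Require Import Reals.
Open Scope R_scope.

Definition pt := (R * R)%type.

Record param := mkParam { tauL : R; deltaL : R; tauR : R; deltaR : R }.

(* The continuous piecewise-linear border-collision normal form. *)
Definition f (xi : param) (P : pt) : pt :=
  let (x, y) := P in
  if Rle_dec x 0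
  then (tauL xi * x + y + 1, - deltaL xi * x)
  else (tauR xi * x + y + 1, - deltaR xi * x).

Fixpoint iterf (xi : param) (n : nat) (P : pt) : pt :=
  match n with
  | O => P
  | S k => f xi (iterf xi k P)
  end.

Definition in_Phi (xi : param) : Prop :=
  tauL xi > deltaL xi + 1 /\ deltaL xi > 0 /\
  tauR xi < - (deltaR xi + 1) /\ deltaR xi > 0.

(* Eigenvalues of A_L (roots of l^2 - tauL l + deltaL), 0 < lamLs < 1 < lamLu *)
Definition lamLu (xi : param) : R :=
  (tauL xi + sqrt (tauL xi ^ 2 - 4 * deltaL xi)) / 2.
Definition lamLs (xi : param) : R :=
  (tauL xi - sqrt (tauL xi ^ 2 - 4 * deltaL xi)) / 2.
(* Eigenvalues of A_R, lamRu < -1 < lamRs < 0 *)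
Definition lamRu (xi : param) : R :=
  (tauR xi - sqrt (tauR xi ^ 2 - 4 * deltaR xi)) / 2.
Definition lamRs (xi : param) : R :=
  (tauR xi + sqrt (tauR xi ^ 2 - 4 * deltaR xi)) / 2.

Definition phi (xi : param) : R :=
  deltaR xi - (tauR xi + deltaL xi + deltaR xi - (1 + tauR xi) * lamLu xi) * lamLu xi.

Definition in_Phi_BYG (xi : param) : Prop := in_Phi xi /\ phi xi > 0.

Definition J1 (xi : param) : R :=
  lamLu xi * (lamRu xi) ^ 2 / (lamLu xi + Rabs (lamRu xi)).

Definition Xfix (xi : param) : pt :=
  (1 / (deltaR xi + 1 - tauR xi), - deltaR xi / (deltaR xi + 1 - tauR xi)).

Definition dist2 (P Q : pt) : R :=
  sqrt ((fst P - fst Q) ^ 2 + (snd P - snd Q) ^ 2).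

Definition pt_cv (u : nat -> pt) (L : pt) : Prop :=
  forall eps, eps > 0 -> exists N, forall n, (n >= N)%nat -> dist2 (u n) L < eps.

Definition Ws (xi : param) : pt -> Prop :=
  fun P => pt_cv (fun n => iterf xi n P) (Xfix xi).

(* Unstable manifold: f^{-n}(P) -> X.  Since f is a homeomorphism for xi in
   Phi, the sequence f^{-n}(P) is the unique backward orbit Q with Q 0 = P and
   f (Q (n+1)) = Q n. *)
Definition Wu (xi : param) : pt -> Prop :=
  fun P => exists Q : nat -> pt,
    Q O = P /\ (forall n, f xi (Q (S n)) = Q n) /\ pt_cv Q (Xfix xi).

Definition closure2 (S : pt -> Prop) : pt -> Prop :=
  fun P => forall eps, eps > 0 -> exists Q, S Q /\ dist2 P Q < eps.

Definition Lambda (xi : param) : pt -> Prop := closure2 (Wu xi).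

Definition filled_triangle (A B C : pt) : pt -> Prop :=
  fun P => exists a b c : R, 0 <= a /\ 0 <= b /\ 0 <= c /\ a + b + c = 1 /\
    P = (a * fst A + b * fst B + c * fst C, a * snd A + b * snd B + c * snd C).

Definition non_collinear (A B C : pt) : Prop :=
  (fst B - fst A) * (snd C - snd A) - (snd B - snd A) * (fst C - fst A) <> 0.

(* Main.v *)
(** Write a = lamLu, b = lamLs, c = |lamRu|, d = |lamRs|. The triangle has a vertex
    at Y, two sides along the stable and unstable lines of Y, and a third side along
    the image of the unstable one; phi > 0 makes it forward invariant. It contains X
    in its interior, so it traps every orbit leaving X, hence Lambda.

    Slopes in [-b, d] form a cone invariant under both linear parts, which stretch
    horizontal distances by at least a and c. If a segment in the cone crosses x = 0,
    then some half of its image has length at least a c / (a + c) times the original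
    one and starts on the image of x = 0. Since b + d < 1, the stable line of X cuts
    the right part of the triangle between x = 0 and its image, so this half meets
    W^s(X) unless it stays in x > 0, where it is stretched by c again, in total by
    J1 > 1. Boundedness of the triangle forces iterates of every small segment to
    meet W^s(X). *)

From Stdlib Require Import Reals Lra Lia.
Require Import Defs.
Open Scope R_scope.

(** * Parametrization by eigenvalues *)

(** The arguments are eigenvalue moduli: the left matrix has eigenvalues a, b and the right one -c,
    -d. This keeps square roots out of all later estimates. *)
Definition nf (a b c d : R) : param := mkParam (a + b) (a * b) (- (c + d)) (c * d).

Lemma f_left a b c d x y : x <= 0 ->
  f (nf a b c d) (x, y) = ((a + b) * x + y + 1, - (a * b) * x).
Proof. intros H. simpl. destruct (Rle_dec x 0); [reflexivity | contradiction]. Qed.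

Lemma f_right a b c d x y : 0 <= x ->
  f (nf a b c d) (x, y) = (- (c + d) * x + y + 1, - (c * d) * x).
Proof.
  intros H. simpl. destruct (Rle_dec x 0); [| reflexivity].
  assert (x = 0) by lra. subst x. f_equal; ring.
Qed.

Lemma eigen_L xi : in_Phi xi ->
  0 < lamLs xi < 1 /\ 1 < lamLu xi /\
  tauL xi = lamLu xi + lamLs xi /\ deltaL xi = lamLu xi * lamLs xi.
Proof.
  intros (H1 & H2 & _). unfold lamLs, lamLu.
  (* This says that the characteristic polynomial is negative at 1, so 1 separates its roots; for
     the right matrix the same happens at -1. *)
  assert (Hd : (tauL xi - 2) ^ 2 < tauL xi ^ 2 - 4 * deltaL xi) by nra.
  assert (Hd0 : 0 <= tauL xi ^ 2 - 4 * deltaL xi)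
    by (pose proof (pow2_ge_0 (tauL xi - 2)); lra).
  pose proof (sqrt_pos (tauL xi ^ 2 - 4 * deltaL xi)) as Hs0.
  pose proof (sqrt_sqrt _ Hd0) as Hs.
  set (r := sqrt _) in *.
  assert (r < tauL xi) by nra.
  assert (tauL xi - 2 < r) by nra.
  assert (2 - tauL xi < r) by nra.
  repeat split; lra || nra.
Qed.

Lemma eigen_R xi : in_Phi xi ->
  -1 < lamRs xi < 0 /\ lamRu xi < -1 /\
  tauR xi = lamRu xi + lamRs xi /\ deltaR xi = lamRu xi * lamRs xi.
Proof.
  intros (_ & _ & H1 & H2). unfold lamRs, lamRu.
  assert (Hd : (tauR xi + 2) ^ 2 < tauR xi ^ 2 - 4 * deltaR xi) by nra.
  assert (Hd0 : 0 <= tauR xi ^ 2 - 4 * deltaR xi)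
    by (pose proof (pow2_ge_0 (tauR xi + 2)); lra).
  pose proof (sqrt_pos (tauR xi ^ 2 - 4 * deltaR xi)) as Hs0.
  pose proof (sqrt_sqrt _ Hd0) as Hs.
  set (r := sqrt _) in *.
  assert (r < - tauR xi) by nra.
  assert (- tauR xi - 2 < r) by nra.
  assert (2 + tauR xi < r) by nra.
  repeat split; lra || nra.
Qed.

(** * Distances and affine functions *)

Lemma dist2_le P Q : dist2 P Q <= Rabs (fst P - fst Q) + Rabs (snd P - snd Q).
Proof.
  unfold dist2. set (u := fst P - fst Q). set (v := snd P - snd Q).
  pose proof (Rabs_pos u). pose proof (Rabs_pos v).
  rewrite <- (sqrt_pow2 (Rabs u + Rabs v)) by lra.
  apply sqrt_le_1_alt.
  rewrite <- (pow2_abs u), <- (pow2_abs v). nra.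
Qed.

Lemma dist2_ge_fst P Q : Rabs (fst P - fst Q) <= dist2 P Q.
Proof.
  unfold dist2. rewrite <- sqrt_Rsqr_abs. apply sqrt_le_1_alt.
  unfold Rsqr. pose proof (pow2_ge_0 (snd P - snd Q)). nra.
Qed.

Lemma dist2_ge_snd P Q : Rabs (snd P - snd Q) <= dist2 P Q.
Proof.
  unfold dist2. rewrite <- sqrt_Rsqr_abs. apply sqrt_le_1_alt.
  unfold Rsqr. pose proof (pow2_ge_0 (fst P - fst Q)). nra.
Qed.

Lemma dist2_sym P Q : dist2 P Q = dist2 Q P.
Proof. unfold dist2. f_equal. ring. Qed.

Lemma iterf_S xi n P : iterf xi (S n) P = iterf xi n (f xi P).
Proof.
  induction n as [| n IH]; [reflexivity |].
  change (iterf xi (S (S n)) P) with (f xi (iterf xi (S n) P)).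
  now rewrite IH.
Qed.

Lemma Ws_f xi P : Ws xi (f xi P) -> Ws xi P.
Proof.
  intros H eps He. destruct (H eps He) as [N HN]. exists (S N).
  intros [| n] Hn; [lia |]. cbv beta. rewrite iterf_S. apply HN. lia.
Qed.

Definition affine (p q r : R) (P : pt) : R := p * fst P + q * snd P + r.

Lemma affine_dist2 p q r P Q :
  Rabs (affine p q r P - affine p q r Q) <= (Rabs p + Rabs q) * dist2 P Q.
Proof.
  unfold affine.
  replace (_ - _) with (p * (fst P - fst Q) + q * (snd P - snd Q)) by ring.
  eapply Rle_trans; [apply Rabs_triang |]. rewrite !Rabs_mult.
  pose proof (dist2_ge_fst P Q). pose proof (dist2_ge_snd P Q).
  pose proof (Rabs_pos p). pose proof (Rabs_pos q). nra.
Qed.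

Lemma affine_pos_near p q r P : 0 < affine p q r P ->
  exists e, e > 0 /\ forall Q, dist2 Q P < e -> 0 <= affine p q r Q.
Proof.
  intros H. pose proof (Rabs_pos p). pose proof (Rabs_pos q).
  (* A Lipschitz constant, increased by 1 to stay positive when p = q = 0. *)
  set (k := Rabs p + Rabs q + 1). assert (Hk : 0 < k) by (unfold k; lra).
  exists (affine p q r P / k). split; [now apply Rdiv_lt_0_compat |].
  intros Q HQ. pose proof (affine_dist2 p q r Q P) as Ha.
  pose proof (Rle_abs (- (affine p q r Q - affine p q r P))) as Hm.
  rewrite Rabs_Ropp in Hm.
  assert (k * dist2 Q P < affine p q r P).
  { apply (Rmult_lt_compat_l k) in HQ; [| lra].
    replace (k * (affine p q r P / k)) with (affine p q r P) in HQ by (field; lra).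
    exact HQ. }
  assert (0 <= dist2 Q P) by apply sqrt_pos.
  unfold k in *. lra.
Qed.

Lemma affine_ge0_closed p q r (S : pt -> Prop) P :
  (forall Q, S Q -> 0 <= affine p q r Q) -> closure2 S P -> 0 <= affine p q r P.
Proof.
  intros HS HP. apply Rnot_lt_le. intros Hn.
  (* Half of the negative value at P is kept in reserve, so that nearby values stay strictly
     negative. *)
  destruct (affine_pos_near (- p) (- q) (- r + affine p q r P / 2) P)
    as (e & He & Hne); [unfold affine in *; lra |].
  destruct (HP e He) as (Q & HQ & HPQ). rewrite dist2_sym in HPQ.
  pose proof (HS Q HQ). pose proof (Hne Q HPQ).
  unfold affine in *. lra.
Qed.

(** * Triangles and segments *)

(** Twice the signed area of the triangle. *)
Definition orient (A B C : pt) : R :=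
  (fst B - fst A) * (snd C - snd A) - (snd B - snd A) * (fst C - fst A).

(** Barycentric coordinates are quotients of signed areas. *)
Lemma filled_triangle_iff A B C P : 0 < orient A B C ->
  filled_triangle A B C P <->
  0 <= orient P B C /\ 0 <= orient A P C /\ 0 <= orient A B P.
Proof.
  intros H. split.
  - intros (u & v & w & Hu & Hv & Hw & Hs & ->).
    replace u with (1 - v - w) by lra.
    assert (0 <= (1 - v - w) * orient A B C) by (apply Rmult_le_pos; lra).
    assert (0 <= v * orient A B C) by (apply Rmult_le_pos; lra).
    assert (0 <= w * orient A B C) by (apply Rmult_le_pos; lra).
    unfold orient in *. simpl. repeat split; lra.
  - intros (H1 & H2 & H3).
    exists (orient P B C / orient A B C), (orient A P C / orient A B C),
      (orient A B P / orient A B C).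
    repeat split.
    1-3: apply Rle_mult_inv_pos; lra.
    + unfold orient in *. field. lra.
    + destruct P as [x y]. unfold orient in *. simpl in *. f_equal; field; lra.
Qed.

Definition seg (P Q : pt) (t : R) : pt :=
  (fst P + t * (fst Q - fst P), snd P + t * (snd Q - snd P)).

Lemma affine_seg p q r P Q t :
  affine p q r (seg P Q t) = (1 - t) * affine p q r P + t * affine p q r Q.
Proof. unfold affine, seg. simpl. ring. Qed.

Lemma affine_zero p q r P Q : affine p q r P < 0 -> 0 <= affine p q r Q ->
  exists t, 0 <= t <= 1 /\ affine p q r (seg P Q t) = 0.
Proof.
  intros HP HQ. exists (- affine p q r P / (affine p q r Q - affine p q r P)).
  split.
  - split.
    + apply Rle_mult_inv_pos; lra.
    + apply Rmult_le_reg_r with (affine p q r Q - affine p q r P); [lra |].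
      unfold Rdiv. rewrite Rmult_assoc, Rinv_l by lra. lra.
  - rewrite affine_seg. field. lra.
Qed.

Lemma seg_sym P Q t : seg P Q t = seg Q P (1 - t).
Proof. unfold seg. f_equal; ring. Qed.

Lemma seg_seg P Q u t : seg P (seg P Q u) t = seg P Q (t * u).
Proof. unfold seg. simpl. f_equal; ring. Qed.

Definition hits (S : pt -> Prop) (P Q : pt) : Prop :=
  exists t, 0 <= t <= 1 /\ S (seg P Q t).

Lemma hits_sym S P Q : hits S P Q -> hits S Q P.
Proof.
  intros (t & Ht & H). exists (1 - t). split; [lra |].
  now rewrite <- seg_sym.
Qed.

Lemma hits_sub S P Q u : 0 <= u <= 1 -> hits S P (seg P Q u) -> hits S P Q.
Proof.
  intros Hu (t & Ht & H). exists (t * u). split; [nra |].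
  now rewrite <- seg_seg.
Qed.

(** * The trapping triangle *)

Section Dynamics.

Variables a b c d : R.
Hypothesis Ha : 1 < a.
Hypothesis Hb : 0 < b < 1.
Hypothesis Hc : 1 < c.
Hypothesis Hd : 0 < d < 1.
(** This is [phi > 0] with traces and determinants expressed by eigenvalues; [HJ] is likewise
    [J1 > 1] with its denominator cleared. *)
Hypothesis Hphi : (a - 1) * (c * d + a * (c + d)) < a ^ 2 * (1 - b).
Hypothesis Hbd : b + d < 1.
Hypothesis HJ : a + c < a * c ^ 2.

Let F := f (nf a b c d).
Let X := Xfix (nf a b c d).

(* The sides of the trapping triangle: [top] and [left] vanish on the unstable
   and stable lines of Y, and [bottom] vanishes on the image of the part of
   [top = 0] in the right half-plane. *)
Definition top : pt -> R := affine (- ((1 - b) * b)) (- (1 - b)) b.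
Definition bottom : pt -> R :=
  affine (- ((1 - b) * (c * d))) ((1 - b) * (b + c + d)) (c * d).
Definition left : pt -> R := affine ((a - 1) * a) (a - 1) a.

Definition Omega (P : pt) : Prop := 0 <= top P /\ 0 <= bottom P /\ 0 <= left P.

Lemma Omega_seg P Q t : 0 <= t <= 1 -> Omega P -> Omega Q -> Omega (seg P Q t).
Proof.
  intros Ht (HP1 & HP2 & HP3) (HQ1 & HQ2 & HQ3).
  unfold Omega, top, bottom, left in *. rewrite !affine_seg.
  repeat split; apply Rplus_le_le_0_compat; apply Rmult_le_pos; lra.
Qed.

(** The difference of the two sides is (b + c)(1 - b - d). Geometrically, the line [bottom = 0]
    meets x = 0 above the stable line of X. *)
Lemma cd_bound : d * (1 + c) < (1 - b) * (b + c + d).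
Proof. assert (0 < (b + c) * (1 - b - d)) by (apply Rmult_lt_0_compat; lra). lra. Qed.

(** The combination (b + c + d) [top] + [bottom] eliminates y; the bound is attained at the vertex
    where both vanish. *)
Lemma Omega_fst_le P : Omega P -> (1 - b) * fst P <= 1.
Proof.
  destruct P as [x y]. unfold Omega, top, bottom, left, affine. simpl.
  intros (HT & HB & _).
  assert (0 < b + c + d) by lra.
  assert (0 <= (b + c + d) * (b - (1 - b) * (b * x + y)))
    by (apply Rmult_le_pos; lra).
  assert (0 < (b * (b + c + d) + c * d)) by nra.
  assert (0 <= (b * (b + c + d) + c * d) * (1 - (1 - b) * x)) by nra.
  assert (0 <= 1 - (1 - b) * x) by nra. lra.
Qed.

(** The left branch multiplies [top] by b and [left] by a, since these vanish on eigenlines through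
    Y. The right branch turns [bottom] of the image into c d [top]. Two other cases add a term in x
    of favourable sign; only [left] after the right branch needs [phi > 0]. *)
Lemma Omega_f P : Omega P -> Omega (F P).
Proof.
  intros H. pose proof (Omega_fst_le P H) as Hx. pose proof cd_bound as Hcd.
  destruct P as [x y]. destruct H as (HT & HB & HS).
  unfold top, bottom, left, affine in HT, HB, HS.
  simpl in Hx, HT, HB, HS.
  assert (Hcd0 : 0 < c * d) by nra.
  unfold F. destruct (Rle_dec x 0) as [Hn | Hp].
  - rewrite f_left by lra.
    unfold Omega, top, bottom, left, affine. simpl. repeat split.
    + assert (0 <= b * (b - (1 - b) * (b * x + y))) by (apply Rmult_le_pos; lra). lra.
    + assert (0 <= (c * d) * (b - (1 - b) * (b * x + y))) by (apply Rmult_le_pos; lra).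
      assert (0 < (b + c + d) * (a * b)) by (repeat apply Rmult_lt_0_compat; lra).
      assert (0 < (c * d) * a) by (apply Rmult_lt_0_compat; lra).
      assert (0 <= (1 - b) * (- x) * ((b + c + d) * (a * b) + (c * d) * a))
        by (repeat apply Rmult_le_pos; lra).
      lra.
    + assert (0 <= a * ((a - 1) * (a * x + y) + a)) by (apply Rmult_le_pos; lra). lra.
  - rewrite f_right by lra.
    unfold Omega, top, bottom, left, affine. simpl. repeat split.
    + assert (0 <= (1 - b) * x * (b * (b + c + d) + c * d))
        by (repeat apply Rmult_le_pos; nra).
      assert (0 <= b * (b - (1 - b) * (b * x + y))) by (apply Rmult_le_pos; lra).
      assert (0 < b * (1 - b)) by nra. lra.
    + assert (0 <= (c * d) * (b - (1 - b) * (b * x + y))) by (apply Rmult_le_pos; lra). lra.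
    + set (k := (1 - b) * (b + c + d)) in *.
      assert (Hk : 0 < k) by (unfold k; apply Rmult_lt_0_compat; lra).
      set (s := (a - 1) * (a * (- (c + d) * x + y + 1) - c * d * x) + a).
      (* Bounding y below by [bottom >= 0] leaves an affine function of x, which
         is positive at x = 0 by b + d < 1 and at x = 1 / (1 - b) by phi > 0. *)
      assert (E : k * s = (a - 1) * a * (k * y - (1 - b) * (c * d) * x + c * d)
        + (1 - (1 - b) * x) * (a * ((a - 1) * (k - c * d) + k))
        + x * (b + c + d) * (1 - b) * (a ^ 2 * (1 - b) - (a - 1) * (c * d + a * (c + d)))).
      { unfold s, k. ring. }
      assert (0 <= k * s).
      { rewrite E. repeat apply Rplus_le_le_0_compat.
        - apply Rmult_le_pos; [apply Rmult_le_pos; lra | lra].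
        - assert (c * d < k) by lra.
          apply Rmult_le_pos; [lra |]. apply Rmult_le_pos; [lra |].
          assert (0 <= (a - 1) * (k - c * d)) by (apply Rmult_le_pos; lra). lra.
        - repeat apply Rmult_le_pos; lra. }
      assert (0 <= s) by nra. unfold s in *. lra.
Qed.

Lemma Xfix_interior : 0 < top X /\ 0 < bottom X /\ 0 < left X.
Proof.
  unfold X, Xfix, top, bottom, left, affine. simpl.
  assert (Hcd : 0 < c * d) by nra.
  assert (Hk : 0 < (1 + c) * (1 + d)) by nra.
  replace (c * d + 1 - - (c + d)) with ((1 + c) * (1 + d)) by ring.
  set (k := (1 + c) * (1 + d)) in *.
  repeat split; apply Rmult_lt_reg_r with k; try lra; rewrite Rmult_0_l.
  - match goal with |- _ < ?l => replace l with (b * k - (1 - b) * (b - c * d)) end.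
    + assert (0 < b * (k - 1)) by (unfold k; apply Rmult_lt_0_compat; nra). nra.
    + field. lra.
  - match goal with |- _ < ?l =>
      replace l with (c * d * (c * d + b * (b + c + d))) end.
    + apply Rmult_lt_0_compat; nra.
    + unfold k. field. split; lra.
  - match goal with |- _ < ?l => replace l with ((a - 1) * (a - c * d) + a * k) end.
    + assert (c * d < k) by (unfold k; nra).
      assert (0 < (a - 1) * (k - c * d)) by (apply Rmult_lt_0_compat; lra).
      nra.
    + field. lra.
Qed.

Lemma Lambda_Omega P : Lambda (nf a b c d) P -> Omega P.
Proof.
  intros H.
  assert (HW : forall Q, Wu (nf a b c d) Q -> Omega Q).
  { intros Q (q & <- & Hq & Hcv). destruct Xfix_interior as (H1 & H2 & H3).
    destruct (affine_pos_near _ _ _ _ H1) as (e1 & He1 & K1).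
    destruct (affine_pos_near _ _ _ _ H2) as (e2 & He2 & K2).
    destruct (affine_pos_near _ _ _ _ H3) as (e3 & He3 & K3).
    destruct (Hcv e1 He1) as [n1 N1]. destruct (Hcv e2 He2) as [n2 N2].
    destruct (Hcv e3 He3) as [n3 N3].
    assert (HN : Omega (q (n1 + n2 + n3)%nat)).
    { repeat split; [apply K1, N1 | apply K2, N2 | apply K3, N3]; lia. }
    revert HN. generalize (n1 + n2 + n3)%nat. intros n.
    (* Forward invariance carries membership down the backward orbit to index 0. *)
    induction n as [| n IH]; [trivial |].
    intros Hn. apply IH. rewrite <- Hq. now apply Omega_f. }
  repeat split; apply affine_ge0_closed with (2 := H); intros Q HQ; now apply HW.
Qed.

(** * The stable line of X *)

(* The line through X in the direction (1, c) of its stable eigenvector. *)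
Definition stable_line : pt -> R := affine c (- 1) (- (c / (1 + c))).

(** On this line the right branch multiplies the displacement from X by -d, so the orbit converges
    as long as it never leaves x >= 0. *)
Lemma stable_line_Ws P : Omega P -> 0 <= fst P -> stable_line P = 0 ->
  Ws (nf a b c d) P.
Proof.
  destruct P as [x y].
  unfold Omega, top, bottom, left, stable_line, affine. simpl. intros (HT & _) Hx HP.
  set (x0 := 1 / ((1 + c) * (1 + d))).
  assert (Hx0 : 0 < x0) by (unfold x0; apply Rdiv_lt_0_compat; nra).
  assert (HX : X = (x0, c * x0 - c / (1 + c))).
  { unfold X, Xfix, x0. simpl. f_equal; field; repeat split; nra. }
  (* The first image stays in x >= 0: [top >= 0] bounds x along the line by 1 / ((1 - b)(1 + c)),
     and d < 1 - b. *)
  assert (Hx1 : d * (x - x0) <= x0).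
  { assert ((1 - b) * (1 + c) * x <= 1).
    { assert (0 < b + c) by lra.
      assert (E : (b + c) * ((1 - b) * (1 + c) * x - 1) =
        - (1 + c) * (- ((1 - b) * b) * x + - (1 - b) * y + b)).
      { replace y with (c * x - c / (1 + c)) by lra. field. lra. }
      nra. }
    assert (x0 * (1 + d) = / (1 + c)) by (unfold x0; field; split; lra).
    assert (d * (1 + c) * x <= 1).
    { assert (d * ((1 + c) * x) <= (1 - b) * ((1 + c) * x))
        by (apply Rmult_le_compat_r; nra). lra. }
    assert (d * x <= / (1 + c)).
    { apply Rmult_le_reg_l with (1 + c); [lra |]. rewrite Rinv_r by lra. lra. }
    lra. }
  (* The displacement alternates in sign, so both bounds are carried along: the second gives the
     first one step later, and conversely. *)
  assert (Hit : forall n, iterf (nf a b c d) n (x, y) =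
      (x0 + (- d) ^ n * (x - x0), c * (x0 + (- d) ^ n * (x - x0)) - c / (1 + c)) /\
      0 <= x0 + (- d) ^ n * (x - x0) /\ d * ((- d) ^ n * (x - x0)) <= x0).
  { induction n as [| n (IH & IH1 & IH2)].
    - simpl. repeat split; try lra. f_equal; lra.
    - simpl iterf. rewrite IH.
      rewrite f_right by exact IH1. simpl pow.
      set (u := (- d) ^ n * (x - x0)) in *.
      replace (- d * (- d) ^ n * (x - x0)) with (- d * u) by (unfold u; ring).
      repeat split.
      + f_equal; unfold x0; field; split; lra.
      + lra.
      + assert (d * d * (x0 + u) >= 0) by nra. nra. }
  intros eps He.
  assert (Hk : 0 < (1 + c) * (Rabs (x - x0) + 1))
    by (pose proof (Rabs_pos (x - x0)); apply Rmult_lt_0_compat; lra).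
  destruct (pow_lt_1_zero (- d)) with (y := eps / ((1 + c) * (Rabs (x - x0) + 1)))
    as [N HN].
  - rewrite Rabs_Ropp, Rabs_pos_eq; lra.
  - now apply Rdiv_lt_0_compat.
  - exists N. intros n Hn. specialize (HN n Hn). destruct (Hit n) as [E _].
    eapply Rle_lt_trans; [apply dist2_le |].
    rewrite E. fold X. rewrite HX. simpl.
    replace (x0 + (- d) ^ n * (x - x0) - x0) with ((- d) ^ n * (x - x0)) by ring.
    replace (_ - (c * x0 - c / (1 + c))) with (c * ((- d) ^ n * (x - x0))) by ring.
    rewrite !Rabs_mult, (Rabs_pos_eq c) by lra.
    apply (Rmult_lt_compat_r _ _ _ Hk) in HN.
    unfold Rdiv in HN. rewrite Rmult_assoc, Rinv_l, Rmult_1_r in HN by lra.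
    pose proof (Rabs_pos ((- d) ^ n)). pose proof (Rabs_pos (x - x0)).
    nra.
Qed.

(** * Expansion of segments in the cone *)

(** The extreme slopes -b and d are the unstable directions of the left and right branches. Length
    is measured horizontally, and l is only a lower bound for it. *)
Definition cone_seg (P Q : pt) (l : R) : Prop :=
  Omega P /\ Omega Q /\ l <= Rabs (fst Q - fst P) /\
  exists s, - b <= s <= d /\ snd Q - snd P = s * (fst Q - fst P).

Let Hits := hits (Ws (nf a b c d)).

Lemma cone_seg_sym P Q l : cone_seg P Q l -> cone_seg Q P l.
Proof.
  intros (HP & HQ & Hl & s & Hs & E). repeat split; try assumption; try apply HP; try apply HQ.
  - now rewrite Rabs_minus_sym.
  - exists s. split; [assumption |]. lra.
Qed.

(** A slope s gives the stretch factor a + b + s >= a and the image slope -ab / (a + b + s), which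
    lies in [-b, 0]. The branch is affine, so a hit on the image pulls back at the same parameter
    t. *)
Lemma cone_seg_left P Q l : fst P <= 0 -> fst Q <= 0 -> cone_seg P Q l ->
  cone_seg (F P) (F Q) (a * l) /\ (Hits (F P) (F Q) -> Hits P Q).
Proof.
  intros HP0 HQ0 (HP & HQ & Hl & s & Hs & E). split.
  - split; [now apply Omega_f |]. split; [now apply Omega_f |].
    destruct P as [x y], Q as [x' y']. unfold F. simpl in HP0, HQ0, E, Hl.
    rewrite !f_left by assumption. simpl.
    replace (_ - ((a + b) * x + y + 1)) with ((a + b + s) * (x' - x)) by lra.
    split.
    + rewrite Rabs_mult, (Rabs_pos_eq (a + b + s)) by lra.
      pose proof (Rabs_pos (x' - x)). nra.
    + exists (- (a * b) / (a + b + s)). split.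
      * split; apply Rmult_le_reg_r with (a + b + s); try lra;
          unfold Rdiv; rewrite Rmult_assoc, Rinv_l by lra; nra.
      * field. lra.
  - intros (t & Ht & H). exists t. split; [assumption |]. apply Ws_f.
    replace (f (nf a b c d) (seg P Q t)) with (seg (F P) (F Q) t); [exact H |].
    destruct P as [x y], Q as [x' y']. unfold F, seg in *. simpl in HP0, HQ0.
    rewrite !f_left; try assumption; simpl; [f_equal; ring | nra].
Qed.

(** Here the factor is -(c + d - s), of modulus at least c, and the image slope lies in [0, d]. *)
Lemma cone_seg_right P Q l : 0 <= fst P -> 0 <= fst Q -> cone_seg P Q l ->
  cone_seg (F P) (F Q) (c * l) /\ (Hits (F P) (F Q) -> Hits P Q).
Proof.
  intros HP0 HQ0 (HP & HQ & Hl & s & Hs & E). split.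
  - split; [now apply Omega_f |]. split; [now apply Omega_f |].
    destruct P as [x y], Q as [x' y']. unfold F. simpl in HP0, HQ0, E, Hl.
    rewrite !f_right by assumption. simpl.
    replace (_ - (- (c + d) * x + y + 1)) with (- (c + d - s) * (x' - x)) by lra.
    split.
    + rewrite Rabs_mult, Rabs_Ropp, (Rabs_pos_eq (c + d - s)) by lra.
      pose proof (Rabs_pos (x' - x)). nra.
    + exists (c * d / (c + d - s)). split.
      * split; apply Rmult_le_reg_r with (c + d - s); try lra;
          unfold Rdiv; rewrite Rmult_assoc, Rinv_l by lra; nra.
      * field. lra.
  - intros (t & Ht & H). exists t. split; [assumption |]. apply Ws_f.
    replace (f (nf a b c d) (seg P Q t)) with (seg (F P) (F Q) t); [exact H |].
    destruct P as [x y], Q as [x' y']. unfold F, seg in *. simpl in HP0, HQ0.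
    rewrite !f_right; try assumption; simpl; [f_equal; ring | nra].
Qed.

Lemma cone_seg_le P Q l l' : l' <= l -> cone_seg P Q l -> cone_seg P Q l'.
Proof.
  intros Hl (HP & HQ & H & E). repeat split; try apply HP; try apply HQ; [lra | exact E].
Qed.

Lemma cone_seg_split P Q l u : 0 <= u <= 1 -> cone_seg P Q l ->
  cone_seg P (seg P Q u) (u * l) /\ cone_seg (seg P Q u) Q ((1 - u) * l).
Proof.
  intros Hu (HP & HQ & Hl & s & Hs & E).
  assert (HM : Omega (seg P Q u)) by now apply Omega_seg.
  pose proof (Rabs_pos (fst Q - fst P)).
  split; (split; [assumption |]; split; [assumption |]; split;
    [| exists s; split; [assumption | simpl; nra]]); simpl.
  - replace (_ - fst P) with (u * (fst Q - fst P)) by ring.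
    rewrite Rabs_mult, Rabs_pos_eq by lra. apply Rmult_le_compat_l; lra.
  - replace (fst Q - _) with ((1 - u) * (fst Q - fst P)) by ring.
    rewrite Rabs_mult, Rabs_pos_eq by lra. apply Rmult_le_compat_l; lra.
Qed.

(** This one inequality puts (0, y) and its image (y + 1, 0) strictly on opposite sides of the
    stable line. *)
Lemma Omega_switching y : Omega (0, y) -> 0 < (1 + c) * y + c.
Proof.
  unfold Omega, bottom, affine. simpl. intros (_ & H & _). pose proof cd_bound.
  assert (0 < (1 - b) * (b + c + d)) by nra.
  assert (0 < c * ((1 - b) * (b + c + d) - d * (1 + c)))
    by (apply Rmult_lt_0_compat; lra).
  nra.
Qed.

(* The stable line separates, inside the triangle, the switching line x = 0
   from its image. *)
Lemma hits_or_right M N : fst M = 0 -> Omega M -> Omega N ->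
  Hits (F M) N \/ 0 < fst N.
Proof.
  intros HM0 HM HN. destruct (Rlt_dec 0 (fst N)) as [| Hn]; [now right | left].
  destruct M as [x y]. simpl in HM0. subst x.
  pose proof (Omega_switching y HM) as Hy.
  assert (HFM : F (0, y) = (y + 1, 0)) by (unfold F; rewrite f_left by lra; f_equal; ring).
  assert (HOF : Omega (F (0, y))) by now apply Omega_f.
  rewrite HFM in *.
  (* The crossing of x = 0 on the way from [F M] to [N]; only the part before it is searched for a
     hit. *)
  destruct (affine_zero (- 1) 0 0 (y + 1, 0) N) as (u & Hu & HS).
  { unfold affine. simpl. nra. }
  { unfold affine. simpl. lra. }
  apply (hits_sub _ _ _ u Hu). apply hits_sym.
  assert (HOS : Omega (seg (y + 1, 0) N u)) by now apply Omega_seg.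
  set (S := seg (y + 1, 0) N u) in *. clearbody S. destruct S as [xs ys].
  unfold affine in HS. simpl in HS. assert (xs = 0) by lra. subst xs.
  pose proof (Omega_switching ys HOS) as Hys.
  assert (Hg : c = (1 + c) * (c / (1 + c))) by (field; lra).
  destruct (affine_zero c (- 1) (- (c / (1 + c))) (0, ys) (y + 1, 0)) as (t & Ht & HZ).
  { unfold affine. simpl. nra. }
  { unfold affine. simpl.
    assert (0 <= c * (y + c / (1 + c))) by (apply Rmult_le_pos; nra).
    assert (c * (c / (1 + c)) = c - c / (1 + c)) by (field; lra). lra. }
  exists t. split; [assumption |]. apply stable_line_Ws.
  - now apply Omega_seg.
  - simpl. nra.
  - exact HZ.
Qed.

(** The first two factors serve segments on one side of x = 0; the third is [J1], for segments that
    cross it. *)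
Definition rate : R := Rmin (Rmin a c) (a * c ^ 2 / (a + c)).

Lemma rate_gt1 : 1 < rate.
Proof.
  unfold rate. repeat apply Rmin_glb_lt; try assumption.
  apply Rmult_lt_reg_r with (a + c); [lra |].
  unfold Rdiv. rewrite Rmult_assoc, Rinv_l by lra. lra.
Qed.

(** Recording only that hits pull back hides how many iterates were taken and which piece was
    kept. *)
Definition grows (P Q : pt) (l : R) : Prop :=
  Hits P Q \/
  exists P' Q', cone_seg P' Q' (rate * l) /\ (Hits P' Q' -> Hits P Q).

Lemma grows_sym P Q l : grows P Q l -> grows Q P l.
Proof.
  intros [H | (P' & Q' & H & K)]; [left; now apply hits_sym |].
  right. exists P', Q'. split; [assumption |]. intros K'. apply hits_sym. exact (K K').
Qed.

(* The longer of the two pieces into which x = 0 cuts the segment has image of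
   length at least [a * c / (a + c) * l]; unless this image meets the stable
   line it lies in x > 0 and is stretched by c once more. *)
Lemma grows_across P Q l : 0 <= l -> fst P < 0 -> 0 < fst Q -> cone_seg P Q l ->
  grows P Q l.
Proof.
  intros Hl HP HQ H.
  destruct (affine_zero 1 0 0 P Q) as (u & Hu & HM0); [unfold affine; lra .. |].
  assert (HM : fst (seg P Q u) = 0) by (unfold affine in HM0; lra).
  assert (HOM : Omega (seg P Q u)) by (apply Omega_seg; [assumption | apply H ..]).
  destruct (cone_seg_split P Q l u Hu H) as [HPM HMQ].
  assert (HitPM : Hits P (seg P Q u) -> Hits P Q) by apply (hits_sub _ _ _ u Hu).
  assert (HitMQ : Hits (seg P Q u) Q -> Hits P Q).
  { intros K. apply hits_sym. apply hits_sub with (1 - u); [lra |].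
    rewrite <- seg_sym. now apply hits_sym. }
  set (M := seg P Q u) in *. clearbody M. apply cone_seg_sym in HPM.
  assert (HMN : forall N, cone_seg (F M) N (a * c / (a + c) * l) ->
      (Hits (F M) N -> Hits P Q) -> grows P Q l).
  { intros N HN HitN.
    destruct (hits_or_right M N HM HOM) as [K | K]; [apply HN | left; exact (HitN K) |].
    assert (HFM : 0 <= fst (F M)).
    { destruct M as [x y]. simpl in HM. subst x.
      pose proof (Omega_switching y HOM). unfold F. rewrite f_left by lra. simpl. nra. }
    destruct (cone_seg_right _ _ _ HFM (Rlt_le _ _ K) HN) as [K1 K2].
    right. exists (F (F M)), (F N). split; [| intros K'; exact (HitN (K2 K'))].
    apply cone_seg_le with (2 := K1).
    replace (c * (a * c / (a + c) * l)) with (a * c ^ 2 / (a + c) * l) by (field; lra).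
    apply Rmult_le_compat_r; [assumption |]. apply Rmin_r. }
  destruct (cone_seg_left M P (u * l)) as [KP KP']; [lra | lra | assumption |].
  destruct (cone_seg_right M Q ((1 - u) * l)) as [KQ KQ']; [lra | lra | assumption |].
  assert (E : (a + c) * (a * c / (a + c)) = a * c) by (field; lra).
  (* The images of the two pieces have the guaranteed lengths a u l and c (1 - u) l, equal at u = c
     / (a + c); the larger is chosen. *)
  destruct (Rle_dec c (u * (a + c))) as [Hcu | Hcu].
  - apply (HMN (F P)); [| intros K; exact (HitPM (hits_sym _ _ _ (KP' K)))].
    apply cone_seg_le with (2 := KP). rewrite <- Rmult_assoc.
    apply Rmult_le_compat_r; [assumption |].
    apply Rmult_le_reg_l with (a + c); nra.
  - apply (HMN (F Q)); [| intros K; exact (HitMQ (KQ' K))].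
    apply cone_seg_le with (2 := KQ). rewrite <- Rmult_assoc.
    apply Rmult_le_compat_r; [assumption |].
    apply Rmult_le_reg_l with (a + c); nra.
Qed.

Lemma cone_seg_grows P Q l : 0 <= l -> cone_seg P Q l -> grows P Q l.
Proof.
  intros Hl H.
  assert (Hra : rate * l <= a * l)
    by (apply Rmult_le_compat_r; [| eapply Rle_trans; [apply Rmin_l | apply Rmin_l]]; lra).
  assert (Hrc : rate * l <= c * l)
    by (apply Rmult_le_compat_r; [| eapply Rle_trans; [apply Rmin_l | apply Rmin_r]]; lra).
  destruct (Rlt_dec (fst P) 0) as [HP | HP], (Rlt_dec (fst Q) 0) as [HQ | HQ].
  - destruct (cone_seg_left P Q l) as [K K']; try lra; try assumption.
    right. exists (F P), (F Q). split; [now apply cone_seg_le with (2 := K) | assumption].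
  - destruct (Req_dec (fst Q) 0) as [H0 | H0].
    + destruct (cone_seg_left P Q l) as [K K']; try lra; try assumption.
      right. exists (F P), (F Q). split; [now apply cone_seg_le with (2 := K) | assumption].
    + apply grows_across; try assumption; lra.
  - destruct (Req_dec (fst P) 0) as [H0 | H0].
    + destruct (cone_seg_left P Q l) as [K K']; try lra; try assumption.
      right. exists (F P), (F Q). split; [now apply cone_seg_le with (2 := K) | assumption].
    + apply grows_sym, grows_across; try assumption; try lra. now apply cone_seg_sym.
  - destruct (cone_seg_right P Q l) as [K K']; try lra; try assumption.
    right. exists (F P), (F Q). split; [now apply cone_seg_le with (2 := K) | assumption].
Qed.

(** * Density of the stable manifold *)

Lemma Omega_bounded : exists m, forall P, Omega P -> Rabs (fst P) <= m.
Proof.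
  (* The sum of the largest abscissa and the modulus of that of Y; the latter comes from eliminating
     y between [top] and [left]. *)
  exists (1 / (1 - b) + (a / (a - 1) + b / (1 - b)) / (a - b)).
  intros P HP. pose proof (Omega_fst_le P HP) as Hx.
  destruct P as [x y]. destruct HP as (HT & _ & HS).
  unfold top, left, affine in HT, HS. simpl in Hx, HT, HS. simpl fst.
  set (A := a / (a - 1)). set (B := b / (1 - b)). set (C := 1 / (1 - b)).
  set (D := (A + B) / (a - b)).
  assert (HA : (a - 1) * A = a) by (unfold A; field; lra).
  assert (HB : (1 - b) * B = b) by (unfold B; field; lra).
  assert (HC : (1 - b) * C = 1) by (unfold C; field; lra).
  assert (HD : (a - b) * D = A + B) by (unfold D; field; lra).
  assert (0 < A) by nra. assert (0 < B) by nra. assert (0 < C) by nra.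
  assert (0 < D) by nra.
  assert (0 <= a * x + y + A) by nra.
  assert (0 <= B - b * x - y) by nra.
  assert (- D <= x) by nra.
  assert (x <= C) by nra.
  apply Rabs_le. lra.
Qed.

Lemma cone_seg_hits P Q l : 0 < l -> cone_seg P Q l -> Hits P Q.
Proof.
  intros Hl. destruct Omega_bounded as [m Hm].
  assert (Hbig : forall l P Q, 2 * m < l -> ~ cone_seg P Q l).
  { intros l' P' Q' Hlm (HP & HQ & H & _).
    apply Hm in HP. apply Hm in HQ.
    pose proof (Rabs_triang (fst Q') (- fst P')). rewrite Rabs_Ropp in *.
    unfold Rminus in H. lra. }
  destruct (Pow_x_infinity rate) with (b := (2 * m + 1) / l) as [N HN].
  { pose proof rate_gt1. rewrite Rabs_pos_eq; lra. }
  specialize (HN N (le_n N)). pose proof rate_gt1 as Hr.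
  assert (Hp : 0 < rate ^ N) by (apply pow_lt; lra).
  rewrite Rabs_pos_eq in HN by lra.
  assert (HNl : 2 * m < rate ^ N * l).
  { apply Rge_le in HN. apply (Rmult_le_compat_r l) in HN; [| lra].
    unfold Rdiv in HN. rewrite Rmult_assoc, Rinv_l in HN by lra. lra. }
  clear HN Hp. revert P Q l Hl HNl.
  (* Each growth step trades one power of [rate] for a factor in l, preserving
     [rate ^ N * l > 2 * m]; at N = 0 the segment is too long for the triangle. *)
  induction N as [| N IH]; intros P Q l Hl HNl H.
  - exfalso. simpl in HNl. apply (Hbig l P Q); [lra | assumption].
  - destruct (cone_seg_grows P Q l) as [K | (P' & Q' & K & K')]; try assumption; [lra |].
    apply K'. apply IH with (rate * l); [nra | | assumption].
    simpl in HNl. lra.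
Qed.

(** A short horizontal segment starting at X is shrunk towards P by a homothety. By convexity it
    stays in [Omega], even for P on the boundary, and it has slope 0, so it must be hit. *)
Lemma Ws_dense P : Omega P ->
  closure2 (fun Q => Ws (nf a b c d) Q /\ Omega Q) P.
Proof.
  intros HP eps He.
  destruct Xfix_interior as (H1 & H2 & H3).
  destruct (affine_pos_near _ _ _ _ H1) as (e1 & He1 & K1).
  destruct (affine_pos_near _ _ _ _ H2) as (e2 & He2 & K2).
  destruct (affine_pos_near _ _ _ _ H3) as (e3 & He3 & K3).
  set (h := Rmin (Rmin e1 e2) e3 / 2).
  assert (Hh0 : 0 < Rmin (Rmin e1 e2) e3) by (repeat apply Rmin_glb_lt; lra).
  assert (Hh : Rmin (Rmin e1 e2) e3 <= e1 /\ Rmin (Rmin e1 e2) e3 <= e2 /\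
    Rmin (Rmin e1 e2) e3 <= e3).
  { pose proof (Rmin_l (Rmin e1 e2) e3). pose proof (Rmin_r (Rmin e1 e2) e3).
    pose proof (Rmin_l e1 e2). pose proof (Rmin_r e1 e2). lra. }
  set (X' := (fst X + h, snd X)).
  assert (HdX : dist2 X' X <= h).
  { eapply Rle_trans; [apply dist2_le |]. unfold X'. simpl.
    replace (fst X + h - fst X) with h by ring. rewrite Rminus_diag, Rabs_R0.
    rewrite Rabs_pos_eq; unfold h; lra. }
  assert (HX' : Omega X') by (repeat split; [apply K1 | apply K2 | apply K3]; unfold h in HdX; lra).
  assert (HX : Omega X) by (repeat split; unfold top, bottom, left in *; lra).
  set (k := Rabs (fst X - fst P) + Rabs (snd X - snd P) + h).
  assert (Hk : 0 < k).
  { unfold k, h. pose proof (Rabs_pos (fst X - fst P)).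
    pose proof (Rabs_pos (snd X - snd P)). lra. }
  (* As k bounds the distance from P to the segment at X, this ratio brings the copy within [eps] of
     P. *)
  set (s := Rmin 1 (eps / (2 * k))).
  assert (Hs : 0 < s <= 1).
  { split; [apply Rmin_glb_lt; [lra | apply Rdiv_lt_0_compat; lra] | apply Rmin_l]. }
  assert (Hsk : s * k < eps).
  { assert (s * k <= eps / (2 * k) * k) by (apply Rmult_le_compat_r; [lra | apply Rmin_r]).
    replace (eps / (2 * k) * k) with (eps / 2) in * by (field; lra). lra. }
  assert (Hh1 : 0 < h) by (unfold h; lra).
  assert (Hseg : cone_seg (seg P X s) (seg P X' s) (s * h)).
  { split; [apply Omega_seg; try assumption; lra |].
    split; [apply Omega_seg; try assumption; lra |]. unfold X'. simpl. split.
    - replace (_ - _) with (s * h) by ring. apply Rle_abs.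
    - exists 0. split; [lra | ring]. }
  destruct (cone_seg_hits _ _ _ (Rmult_lt_0_compat _ _ (proj1 Hs) Hh1) Hseg)
    as (t & Ht & HW).
  exists (seg (seg P X s) (seg P X' s) t). split.
  - split; [exact HW |]. apply Omega_seg; [exact Ht | apply Hseg ..].
  - rewrite dist2_sym. eapply Rle_lt_trans; [apply dist2_le |].
    unfold X', seg. cbn [fst snd].
    replace (Rabs _ + Rabs _) with
      (Rabs (s * (fst X - fst P + t * h)) + Rabs (s * (snd X - snd P)))
      by (f_equal; f_equal; ring).
    rewrite !Rabs_mult, (Rabs_pos_eq s) by lra.
    pose proof (Rabs_triang (fst X - fst P) (t * h)) as Htr.
    rewrite Rabs_mult, (Rabs_pos_eq t), (Rabs_pos_eq h) in Htr by lra.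
    assert (t * h <= h) by nra.
    eapply Rle_lt_trans; [| exact Hsk].
    rewrite <- Rmult_plus_distr_l. apply Rmult_le_compat_l; unfold k; lra.
Qed.

(** * The trapping region as a triangle *)

Lemma Omega_triangle : exists A B C, 0 < orient A B C /\
  forall P, filled_triangle A B C P <-> Omega P.
Proof.
  set (n := a * (b + c + d) + c * d).
  assert (Hcd : 0 < c * d) by nra.
  assert (Hn : 0 < n) by (unfold n; nra).
  (* B is the intersection of [bottom = 0] and [left = 0]. *)
  set (xB := (c * d / (1 - b) - (b + c + d) * a / (a - 1)) / n).
  set (B := (xB, - a / (a - 1) - a * xB)).
  (* D is the common zero of [top] and [bottom], the image of the point where the unstable line of Y
     crosses x = 0. *)
  set (D := (1 / (1 - b), 0)).
  set (Y := (- 1 / ((a - 1) * (1 - b)), a * b / ((a - 1) * (1 - b)))).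
  (* Each area form vanishes on the same line as one side function, hence is a multiple of it; only
     the sign of the factor matters. *)
  assert (Hbot : forall P, orient P B D =
    a * (a - b) / (n * (1 - b) ^ 2 * (a - 1)) * bottom P).
  { intros [x y]. unfold orient, bottom, affine, B, D, xB, n. simpl.
    field. repeat split; unfold n in Hn; lra. }
  assert (Htop : forall P, orient Y P D = a / ((a - 1) * (1 - b) ^ 2) * top P).
  { intros [x y]. unfold orient, top, affine, Y, D. simpl.
    field. repeat split; lra. }
  assert (Hleft : forall P, orient Y B P =
    a * (c * d + b * (b + c + d)) / (n * (a - 1) ^ 2 * (1 - b)) * left P).
  { intros [x y]. unfold orient, left, affine, B, Y, xB, n. simpl.
    field. repeat split; unfold n in Hn; lra. }
  assert (Kbot : 0 < a * (a - b) / (n * (1 - b) ^ 2 * (a - 1))).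
  { apply Rdiv_lt_0_compat; simpl; repeat apply Rmult_lt_0_compat; lra. }
  assert (Ktop : 0 < a / ((a - 1) * (1 - b) ^ 2)).
  { apply Rdiv_lt_0_compat; simpl; repeat apply Rmult_lt_0_compat; lra. }
  assert (Kleft : 0 < a * (c * d + b * (b + c + d)) / (n * (a - 1) ^ 2 * (1 - b))).
  { apply Rdiv_lt_0_compat; simpl; repeat apply Rmult_lt_0_compat; try lra. nra. }
  assert (Hpos : 0 < orient Y B D).
  { rewrite Hbot. apply Rmult_lt_0_compat; [assumption |].
    replace (bottom Y) with (a * (b * (b + c + d) + c * d) / (a - 1))
      by (unfold bottom, affine, Y; simpl; field; lra).
    apply Rdiv_lt_0_compat; [apply Rmult_lt_0_compat; nra | lra]. }
  exists Y, B, D. split; [exact Hpos |]. intros P.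
  rewrite (filled_triangle_iff _ _ _ _ Hpos), Hbot, Htop, Hleft.
  assert (Hsgn : forall k v, 0 < k -> (0 <= k * v <-> 0 <= v))
    by (intros k v Hk; split; intros; nra).
  rewrite !Hsgn by assumption. unfold Omega. tauto.
Qed.

End Dynamics.

Theorem theorem2p1 (xi : param) :
  in_Phi_BYG xi ->
  J1 xi > 1 ->
  lamLs xi + Rabs (lamRs xi) < 1 ->
  exists A B C : pt,
    non_collinear A B C /\
    (forall P, Lambda xi P -> filled_triangle A B C P) /\
    (forall P, filled_triangle A B C P ->
       closure2 (fun Q => Ws xi Q /\ filled_triangle A B C Q) P).
Proof.
  intros [HPhi Hphi] HJ Hbd.
  destruct (eigen_L xi HPhi) as (Hb & Ha & EtL & EdL).
  destruct (eigen_R xi HPhi) as (Hd & Hc & EtR & EdR).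
  unfold J1 in HJ. unfold phi in Hphi.
  rewrite Rabs_left in HJ, Hbd by lra.
  (* The right eigenvalues are negative, so their moduli are their opposites. *)
  assert (Exi : xi = nf (lamLu xi) (lamLs xi) (- lamRu xi) (- lamRs xi)).
  { unfold nf. rewrite <- EtL, <- EdL, Rmult_opp_opp, <- EdR.
    replace (- (_ + _)) with (tauR xi) by lra. now destruct xi. }
  rewrite EdL, EtR, EdR in Hphi.
  set (a := lamLu xi) in *. set (b := lamLs xi) in *.
  set (c := lamRu xi) in *. set (d := lamRs xi) in *.
  assert (HJ' : a + - c < a * (- c) ^ 2).
  { apply Rgt_lt, (Rmult_lt_compat_r (a + - c)) in HJ; [| lra].
    unfold Rdiv in HJ. rewrite Rmult_assoc, Rinv_l in HJ by lra. lra. }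
  clearbody a b c d. rewrite Exi.
  destruct (Omega_triangle a b (- c) (- d)) as (A & B & C & Hpos & HT); try lra.
  exists A, B, C. split; [apply Rgt_not_eq; exact Hpos |]. split.
  - intros P HP. apply HT.
    apply Lambda_Omega; try lra. exact HP.
  - intros P HP eps He.
    destruct (Ws_dense a b (- c) (- d)) with (P := P) (eps := eps) as (Q & [HW HQ] & HPQ);
      try lra; [now apply HT |].
    exists Q. split; [split; [exact HW | now apply HT] | exact HPQ].
Qed.
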